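(* Let $T>0$ and let $\zeta:]-T,T[\rightarrow\mathbb{H}$ be a smooth horizontal curve parametrized by arc length in the Heisenberg group that forms at time $t$ an angle $\theta(t)$ with $X_1$, i.e. $\zeta'(t)=\cos(\theta(t))X_1(\zeta(t))+\sin(\theta(t))X_2(\zeta(t))$ with $\theta$ smooth. Let $\overline{\nabla}$ be the Tanaka-Webster connection. Then for every $t\in\,]-T,T[$, $$\overline{\nabla}_{\zeta'(t)}\zeta'=h_\zeta(t)\left(-\sin(\theta(t))X_1(\zeta(t))+\cos(\theta(t))X_2(\zeta(t))\right).$$ In particular, $\left\Vert\overline{\nabla}_{\zeta'(t)}\zeta'\right\Vert_{\mathbb{H}}=|h_\zeta(t)|$.
   Context: The Heisenberg group $\mathbb{H}$ is $\mathbb{R}^3$ with coordinates $(x,y,z)$, endowed with the two-dimensional distribution spanned by $X_1=\frac{\partial}{\partial x}-\frac{y}{2}\frac{\partial}{\partial z}$ and $X_2=\frac{\partial}{\partial y}+\frac{x}{2}\frac{\partial}{\partial z}$, with the metric $g$ on the distribution for which $(X_1,X_2)$ is an orthonormal frame; $\Vert\cdot\Vert_{\mathbb{H}}$ is the associated norm on horizontal vectors. Put $X_3=\frac{\partial}{\partial z}$ (the Reeb vector field). A vector field is horizontal if it is everywhere in the distribution. A smooth curve is horizontal if it is everywhere tangent to the distribution, and parametrized by arc length if its velocity has $\Vert\cdot\Vert_{\mathbb{H}}$-norm $1$ everywhere. For a smooth horizontal curve $\zeta(t)=(x(t),y(t),z(t))$ parametrized by arc length, the characteristic deviation is $h_\zeta(t)=\dot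 x(t)\ddot y(t)-\dot y(t)\ddot x(t)$. The Tanaka-Webster connection $\overline{\nabla}$ in the Heisenberg group is the affine connection on $\mathbb{R}^3$ such that: (1) $X_3$ is parallel with respect to $\overline{\nabla}$; (2) for any horizontal vector field $X$ and any vector field $Y$, $\overline{\nabla}_YX$ is horizontal; (3) $\overline{\nabla}g=0$, i.e. $Y g(X,X')=g(\overline{\nabla}_YX,X')+g(X,\overline{\nabla}_YX')$ for $X,X'$ horizontal and $Y$ any vector field; (4) the torsion $\overline{\nabla}_XY-\overline{\nabla}_YX-[X,Y]$ of any two horizontal vector fields $X,Y$ is collinear to $X_3$; (5) $\overline{\nabla}_{X_3}X_i=0$ for every $i\in\{1,2,3\}$. Here $\overline{\nabla}_{\zeta'(t)}\zeta'$ is the covariant derivative of the velocity field along $\zeta$. *)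

(* Defs.v *)
(* The real line is an arbitrary [R : realType]. *)
From HB Require Import structures.
From mathcomp Require Export all_boot all_order all_algebra.
From mathcomp Require Export all_classical all_reals all_analysis.
Export Order.TTheory GRing.Theory Num.Theory.
Export numFieldNormedType.Exports.

Set Implicit Arguments.
Unset Strict Implicit.
Unset Printing Implicit Defensive.

Local Open Scope ring_scope.
Local Open Scope classical_set_scope.

(* On an open subset of a finite-dimensional space, iterating directional
   derivatives in all directions gives the usual class C^k. *)
Fixpoint Ck (R : realType) (V W : normedModType R) (U : set V) (k : nat)
    (f : V -> W) : Prop :=
  (forall p, U p -> {for p, continuous f}) /\
  match k with
  | 0 => True
  | k'.+1 => forall v, (forall p, U p -> derivable f p v) /\ Ck U k' ('D_v f)
  end.

Definition smooth_on (R : realType) (V W : normedModType R) (U : set V)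
    (f : V -> W) : Prop := forall k, Ck U k f.

(* Points (x, y, z) of H, and tangent vectors in the basis d/dx, d/dy, d/dz:
   the tangent space at each point is identified with R^3. *)
Notation heis R := 'rV[R]_3.

Definition xc {R : realType} (p : heis R) : R := p 0 0.
Definition yc {R : realType} (p : heis R) : R := p 0 1.

Definition partial_ {R : realType} (i : 'I_3) : heis R := delta_mx 0 i.

(* A vector field may be any function; smoothness is required separately. *)
Definition vfield (R : realType) : Type := heis R -> heis R.

Definition smooth_vf (R : realType) (X : vfield R) : Prop := smooth_on setT X.
Definition smooth_fun (R : realType) (f : heis R -> R) : Prop :=
  smooth_on setT f.

Definition X1 {R : realType} : vfield R :=
  fun p => partial_ 0 - (yc p / 2) *: partial_ 2.
Definition X2 {R : realType} : vfield R :=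
  fun p => partial_ 1 + (xc p / 2) *: partial_ 2.
Definition X3 {R : realType} : vfield R := fun=> partial_ 2.

Definition in_distribution (R : realType) (p v : heis R) : Prop :=
  exists a b : R, v = a *: X1 p + b *: X2 p.

Definition horizontal_vf (R : realType) (X : vfield R) : Prop :=
  forall p, in_distribution p (X p).

(* The metric, meaningful on horizontal vectors only: a *: X1 p + b *: X2 p has
   first two coordinates a and b, so this is the inner product that makes
   (X1 p, X2 p) orthonormal (see [gH_frame]). *)
Definition gH (R : realType) (p v w : heis R) : R := xc v * xc w + yc v * yc w.

Lemma gH_frame (R : realType) (p : heis R) (a b a' b' : R) :
  gH p (a *: X1 p + b *: X2 p) (a' *: X1 p + b' *: X2 p) = a * a' + b * b'.
Proof.
rewrite /gH /xc /yc /X1 /X2 /partial_ !mxE /=.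
by rewrite !(mulr0n, mulr1n) !(mulr0, subr0, mulr1, addr0, add0r).
Qed.

Definition normH (R : realType) (p v : heis R) : R := Num.sqrt (gH p v v).

Definition horizontal_curve (R : realType) (I : set R) (zeta : R -> heis R) :=
  forall t, I t -> in_distribution (zeta t) (derive1 zeta t).

Definition arc_length_param (R : realType) (I : set R) (zeta : R -> heis R) :=
  forall t, I t -> normH (zeta t) (derive1 zeta t) = 1.

Definition char_deviation (R : realType) (zeta : R -> heis R) (t : R) : R :=
  let x := xc \o zeta in
  let y := yc \o zeta in
  derive1 x t * derive1n 2 y t - derive1 y t * derive1n 2 x t.

(* ['D_(X p) f p] is (X f)(p). *)
Definition lie_bracket (R : realType) (X Y : vfield R) : vfield R :=
  fun p => 'D_(X p) Y p - 'D_(Y p) X p.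

(* [nabla Y X] is the covariant derivative of X in the direction Y; only its
   values on smooth fields matter. *)
Record affine_connection (R : realType)
    (nabla : vfield R -> vfield R -> vfield R) : Prop := AffineConnection {
  conn_smooth : forall Y X, smooth_vf Y -> smooth_vf X ->
    smooth_vf (nabla Y X);
  conn_addl : forall Y Y' X, smooth_vf Y -> smooth_vf Y' -> smooth_vf X ->
    forall p, nabla (fun q => Y q + Y' q) X p = nabla Y X p + nabla Y' X p;
  conn_scalel : forall f Y X, smooth_fun f -> smooth_vf Y -> smooth_vf X ->
    forall p, nabla (fun q => f q *: Y q) X p = f p *: nabla Y X p;
  conn_addr : forall Y X X', smooth_vf Y -> smooth_vf X -> smooth_vf X' ->
    forall p, nabla Y (fun q => X q + X' q) p = nabla Y X p + nabla Y X' p;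
  conn_leibniz : forall f Y X, smooth_fun f -> smooth_vf Y -> smooth_vf X ->
    forall p, nabla Y (fun q => f q *: X q) p =
              ('D_(Y p) f p) *: X p + f p *: nabla Y X p
}.

Definition torsion (R : realType) (nabla : vfield R -> vfield R -> vfield R)
    (X Y : vfield R) : vfield R :=
  fun p => nabla X Y p - nabla Y X p - lie_bracket X Y p.

Record tanaka_webster (R : realType)
    (nabla : vfield R -> vfield R -> vfield R) : Prop := TanakaWebster {
  tw_connection : affine_connection nabla;
  tw_reeb_parallel : forall Y, smooth_vf Y ->
    forall p, nabla Y X3 p = 0;
  tw_horizontal : forall X Y, smooth_vf X -> horizontal_vf X -> smooth_vf Y ->
    horizontal_vf (nabla Y X);
  tw_metric : forall X X' Y,
    smooth_vf X -> horizontal_vf X -> smooth_vf X' -> horizontal_vf X' ->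
    smooth_vf Y ->
    forall p, 'D_(Y p) (fun q => gH q (X q) (X' q)) p =
              gH p (nabla Y X p) (X' p) + gH p (X p) (nabla Y X' p);
  tw_torsion : forall X Y,
    smooth_vf X -> horizontal_vf X -> smooth_vf Y -> horizontal_vf Y ->
    forall p, exists c : R, torsion nabla X Y p = c *: X3 p;
  tw_reeb : forall p,
    [/\ nabla X3 X1 p = 0,
        nabla X3 X2 p = 0 &
        nabla X3 X3 p = 0]
}.

(* nabla_v X at p, for a tangent vector v at p.  Since [nabla] is tensorial in
   its first argument, any smooth field extending v would do; take the
   constant one. *)
Definition nabla_at (R : realType) (nabla : vfield R -> vfield R -> vfield R)
    (p v : heis R) (X : vfield R) : heis R := nabla (fun=> v) X p.

(* Covariant derivative of a vector field V along the curve zeta: writing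
   V = sum_j V_j d_j, it is sum_j (V_j' d_j + V_j nabla_{zeta'} d_j). *)
Definition covariant_derivative_along (R : realType)
    (nabla : vfield R -> vfield R -> vfield R)
    (zeta : R -> heis R) (V : R -> heis R) (t : R) : heis R :=
  \sum_(j < 3) (derive1 (fun s => V s 0 j) t *: partial_ j +
                V t 0 j *: nabla_at nabla (zeta t) (derive1 zeta t)
                                    (fun=> partial_ j)).

(* Main.v *)
(* Metric compatibility makes the connection act on the frame (X1, X2) by a skew
   matrix, and since [X1, X2] = X3 the torsion condition kills it: X1, X2, X3 are
   all parallel.  Writing d/dx = X1 + (y/2) X3 and d/dy = X2 - (x/2) X3 gives the
   covariant derivatives of the coordinate fields; along a curve their
   contributions cancel, so the covariant derivative of the velocity is the
   ordinary acceleration, which equals theta' (- sin theta X1 + cos theta X2). *)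
Require Import Defs.
From HB Require Import structures.
From mathcomp Require Import ring.

Set Implicit Arguments.
Unset Strict Implicit.
Unset Printing Implicit Defensive.

Local Open Scope ring_scope.
Local Open Scope classical_set_scope.

(** * Affine maps: derivatives and smoothness *)

Lemma is_derive_affine (R : realType) (V W : normedModType R)
    (L : V -> W) (c : W) (p v : V) :
  linear L -> continuous L -> is_derive p v (fun q => L q + c) (L v).
Proof.
move=> linL contL.
(* Linearity of [L] is only a proposition here; bundling it gives access to the differential of a
   linear map, which is the map itself. *)
pose L' : {linear V -> W} :=
  HB.pack L (GRing.isLinear.Build _ _ _ _ L linL).
have dL : differentiable L' p by apply: linear_differentiable; exact: contL.
have L'v : is_derive p v L' (L v).
  by split; [exact: diff_derivable|rewrite deriveE // diff_lin].
rewrite -[L v]addr0.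
exact: is_deriveD.
Qed.

(** Induction on the order, over all [L] and [c]: a directional derivative of an affine map is
    constant, hence affine with linear part zero. *)
Lemma smooth_affine (R : realType) (V W : normedModType R) (U : set V)
    (L : V -> W) (c : W) :
  linear L -> continuous L -> smooth_on U (fun p => L p + c).
Proof.
move=> linL contL k.
have contA (L' : V -> W) c' : continuous L' ->
    forall p, {for p, continuous (fun q => L' q + c')}.
  by move=> cL' p; apply: cvgD; [exact: cL'|exact: cvg_cst].
elim: k => [|k IHk] in L c linL contL *; split; do ?by move=> p _; exact: contA.
  exact: I.
move=> v; split=> [p _|].
  by have [] := is_derive_affine c p v linL contL.
have -> : 'D_v (fun q => L q + c) = (fun=> 0 + L v).
  apply/funext => p; rewrite add0r.
  by have [] := is_derive_affine c p v linL contL.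
apply: (IHk (fun=> 0)); last exact: cst_continuous.
by move=> a x y; rewrite scaler0 addr0.
Qed.

Lemma smooth_cst (R : realType) (V W : normedModType R) (U : set V) (c : W) :
  smooth_on U (fun=> c).
Proof.
rewrite (_ : (fun=> c) = (fun p : V => (fun=> 0) p + c)); last first.
  by apply/funext => p; rewrite add0r.
apply: smooth_affine; last exact: cst_continuous.
by move=> a x y; rewrite scaler0 addr0.
Qed.

Lemma continuous_coordZ (R : realType) (n : nat) (W : normedModType R)
    (i : 'I_n) (w : W) : continuous (fun p : 'rV[R]_n => p 0 i *: w).
Proof.
move=> p; apply: (@continuous_comp _ _ _
  (fun q : 'rV[R]_n => q 0 i) ( *:%R ^~ w)).
  exact: coord_continuous.
exact: scalel_continuous.
Qed.

Lemma linear_coordZ (R : realType) (n : nat) (W : normedModType R)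
    (i : 'I_n) (w : W) :
  linear (fun p : 'rV[R]_n => p 0 i *: w).
Proof. by move=> a x y; rewrite !mxE scalerDl scalerA. Qed.

Lemma derive_coordZ (R : realType) (n : nat) (W : normedModType R) (i : 'I_n)
    (w c : W) (p v : 'rV[R]_n) :
  'D_v (fun q : 'rV[R]_n => q 0 i *: w + c) p = v 0 i *: w.
Proof.
have [] := is_derive_affine c p v (linear_coordZ i w).
  exact: continuous_coordZ.
by [].
Qed.

(** * The frame X1, X2, X3 in coordinates *)

Section Frame.
Context {R : realType}.
Implicit Types (p v w : heis R).

Lemma heis_ext v w :
  v 0 0 = w 0 0 -> v 0 1 = w 0 1 -> v 0 2 = w 0 2 -> v = w.
Proof.
move=> e0 e1 e2; apply/rowP => -[[|[|[|//]]] lti].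
- by rewrite (_ : Ordinal lti = 0) //; exact/val_inj.
- by rewrite (_ : Ordinal lti = 1) //; exact/val_inj.
- by rewrite (_ : Ordinal lti = 2) //; exact/val_inj.
Qed.

Definition coordE :=
  (mxE, mulr0n, mulr1n, mulr0, mulr1, subr0, addr0, add0r, oppr0).

Lemma X1E p :
  [/\ (X1 p : heis R) 0 0 = 1, X1 p 0 1 = 0 & X1 p 0 2 = - (yc p / 2)].
Proof. by split; rewrite /X1 /partial_ !mxE /= ?coordE. Qed.

Lemma X2E p :
  [/\ (X2 p : heis R) 0 0 = 0, X2 p 0 1 = 1 & X2 p 0 2 = xc p / 2].
Proof. by split; rewrite /X2 /partial_ !mxE /= ?coordE. Qed.

Lemma X1_affine :
  (X1 : vfield R) = (fun p => p 0 1 *: (- 2^-1 *: partial_ 2) + partial_ 0).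
Proof.
apply/funext => p.
by rewrite /X1 /yc scalerA mulrN scaleNr addrC.
Qed.

Lemma X2_affine :
  (X2 : vfield R) = (fun p => p 0 0 *: (2^-1 *: partial_ 2) + partial_ 1).
Proof.
apply/funext => p.
by rewrite /X2 /xc scalerA addrC.
Qed.

(** Common normal form for the fields and coefficients met when a constant vector is expanded in the
    frame. *)
Lemma smooth_affine_xy (W : normedModType R) (a b c : W) :
  smooth_on setT (fun q : heis R => q 0 0 *: a + q 0 1 *: b + c).
Proof.
apply: (@smooth_affine _ _ _ _ (fun q : heis R => q 0 0 *: a + q 0 1 *: b)).
  by move=> k x y; rewrite !linear_coordZ scalerDr addrACA.
move=> q; apply: (@continuousD _ _ _ (fun q : heis R => q 0 0 *: a)
  (fun q : heis R => q 0 1 *: b)); exact: continuous_coordZ.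
Qed.

Lemma smooth_X3 : smooth_vf (X3 : vfield R).
Proof. exact: smooth_cst. Qed.

Lemma smooth_X1 : smooth_vf (X1 : vfield R).
Proof.
rewrite X1_affine.
by apply: smooth_affine; [exact: linear_coordZ|exact: continuous_coordZ].
Qed.

Lemma smooth_X2 : smooth_vf (X2 : vfield R).
Proof.
rewrite X2_affine.
by apply: smooth_affine; [exact: linear_coordZ|exact: continuous_coordZ].
Qed.

Lemma horizontal_X1 : horizontal_vf (X1 : vfield R).
Proof. by move=> p; exists 1, 0; rewrite scale1r scale0r addr0. Qed.

Lemma horizontal_X2 : horizontal_vf (X2 : vfield R).
Proof. by move=> p; exists 0, 1; rewrite scale1r scale0r add0r. Qed.

Lemma smooth_coordZ_X3 (i : 'I_3) (a : R) :
  smooth_vf (fun q : heis R => (q 0 i * a) *: X3 q).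
Proof.
rewrite (_ : (fun q => _) = (fun q : heis R => q 0 i *: (a *: partial_ 2) + 0)).
  by apply: smooth_affine; [exact: linear_coordZ|exact: continuous_coordZ].
by apply/funext => q; rewrite addr0 scalerA.
Qed.

Lemma gH_X1 p v : gH p v (X1 p) = v 0 0.
Proof. by rewrite /gH /xc /yc; have [-> -> _] := X1E p; rewrite !coordE. Qed.

Lemma gH_X2 p v : gH p v (X2 p) = v 0 1.
Proof. by rewrite /gH /xc /yc; have [-> -> _] := X2E p; rewrite !coordE. Qed.

Lemma gHC p v w : gH p v w = gH p w v.
Proof. by rewrite /gH mulrC [yc _ * _]mulrC. Qed.

(** The first two coordinates of a horizontal vector are its coefficients on [X1] and [X2]. *)
Lemma in_distribution_eq0 p v :
  in_distribution p v -> v 0 0 = 0 -> v 0 1 = 0 -> v = 0.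
Proof.
move=> [a [b ->]]; case: (X1E p) (X2E p).
move: (X1 p) (X2 p) => u w u0 u1 _ [w0 w1 _].
rewrite !mxE u0 u1 w0 w1 !coordE => -> ->.
by rewrite !scale0r addr0.
Qed.

(** Differentiating [X2] along [X1] gives half of [partial_ 2], and [X1] along [X2] gives minus
    half. *)
Lemma lie_bracket_X1_X2 p : lie_bracket X1 X2 p = X3 p.
Proof.
rewrite /lie_bracket.
have [x1 _ _] := X1E p; have [_ x2 _] := X2E p.
rewrite [in X in X - _]X2_affine [in X in _ - X]X1_affine !derive_coordZ.
rewrite [X in X *: _]x1 [X in _ - X *: _]x2.
by rewrite !scale1r -scalerBl opprK -div1r -splitr scale1r.
Qed.

End Frame.

(** * The connection on the frame and on the coordinate fields *)

Section TanakaWebster.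
Context {R : realType} {nabla : vfield R -> vfield R -> vfield R}.
Hypothesis nabla_TW : tanaka_webster nabla.
Let nabla_conn := tw_connection nabla_TW.

Lemma tw_frame_skew (Y : vfield R) (p : heis R) : smooth_vf Y ->
  [/\ nabla Y X1 p 0 0 = 0, nabla Y X2 p 0 1 = 0 &
      nabla Y X1 p 0 1 + nabla Y X2 p 0 0 = 0].
Proof.
move=> sY.
(* When the inner product of two fields is constant, the derivative in the metric condition
   vanishes. It is applied below to the pairs of frame fields, with constants 1, 1 and 0. *)
have met X X' c (sX : smooth_vf X) (hX : horizontal_vf X) (sX' : smooth_vf X')
    (hX' : horizontal_vf X') (e : forall q, gH q (X q) (X' q) = c) :
    gH p (nabla Y X p) (X' p) + gH p (X p) (nabla Y X' p) = 0.
  rewrite -(tw_metric nabla_TW sX hX sX' hX' sY).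
  rewrite (_ : (fun q => _) = cst c); first exact: derive_cst.
  exact/funext.
have double0 (a : R) : a + a = 0 -> a = 0.
  by move/eqP; rewrite -mulr2n mulrn_eq0 => /eqP.
have [s1 s2] := (@smooth_X1 R, @smooth_X2 R).
have [h1 h2] := (@horizontal_X1 R, @horizontal_X2 R).
split.
- apply: double0; rewrite -{1}(gH_X1 p) -(gH_X1 p).
  rewrite [X in _ + X]gHC; apply: (met _ _ 1) => // q.
  by rewrite gH_X1; have [] := X1E q.
- apply: double0; rewrite -{1}(gH_X2 p) -(gH_X2 p).
  rewrite [X in _ + X]gHC; apply: (met _ _ 1) => // q.
  by rewrite gH_X2; have [] := X2E q.
- rewrite -(gH_X2 p) -(gH_X1 p) [X in _ + X]gHC; apply: (met _ _ 0) => // q.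
  by rewrite gH_X2; have [] := X1E q.
Qed.

Lemma tw_frame_parallel p :
  [/\ nabla X1 X1 p = 0, nabla X1 X2 p = 0, nabla X2 X1 p = 0 &
      nabla X2 X2 p = 0].
Proof.
have [s1 s2] := (@smooth_X1 R, @smooth_X2 R).
have [h1 h2] := (@horizontal_X1 R, @horizontal_X2 R).
have [a0 b1 a1b0] := tw_frame_skew p s1.
have [c0 d1 c1d0] := tw_frame_skew p s2.
have [k] := tw_torsion nabla_TW s1 h1 s2 h2 p.
rewrite /torsion lie_bracket_X1_X2 => /eqP; rewrite subr_eq => /eqP tor.
(* By [tor], the two mixed derivatives differ by a multiple of [X3], so their first two coordinates
   agree; skewness already kills one side in each coordinate. *)
have b0 : nabla X1 X2 p 0 0 = 0.
  move/(congr1 (fun v : heis R => v 0 0)): tor.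
  by rewrite !mxE c0 /= !coordE.
have c1 : nabla X2 X1 p 0 1 = 0.
  move/(congr1 (fun v : heis R => v 0 1)): tor.
  by rewrite !mxE b1 /= !coordE => /eqP; rewrite oppr_eq0 => /eqP.
(* Horizontality leaves only the first two coordinates to check; the off-diagonal skew relations
   supply the last ones. *)
split; apply: (@in_distribution_eq0 _ p) => //.
- exact: tw_horizontal.
- by rewrite b0 addr0 in a1b0.
- exact: tw_horizontal.
- exact: tw_horizontal.
- exact: tw_horizontal.
- by rewrite c1 add0r in c1d0.
Qed.

(* By tensoriality, write the constant field v in the frame X1, X2, X3. *)
Lemma tw_nabla_cst (X : vfield R) (p v : heis R) : smooth_vf X ->
  (forall q, nabla X1 X q = 0) -> (forall q, nabla X2 X q = 0) ->
  (forall q, nabla X3 X q = 0) -> nabla_at nabla p v X = 0.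
Proof.
move=> sX e1 e2 e3.
(* The coefficient of [X3] in the constant field [v]: it is [v 0 2] minus the vertical coordinate of
   [v 0 0 *: X1 q + v 0 1 *: X2 q]. *)
pose f (q : heis R) : R :=
  q 0 0 *: (- (v 0 1 / 2)) + q 0 1 *: (v 0 0 / 2) + v 0 2.
have sf : smooth_fun f by exact: smooth_affine_xy.
(* The connection rules are stated for smooth fields, so each summand and partial sum is put in
   affine form. *)
have s1 : smooth_vf (fun q => v 0 0 *: X1 q).
  rewrite (_ : (fun q => _) = (fun q : heis R => q 0 0 *: 0 +
    q 0 1 *: (- (v 0 0 / 2) *: partial_ 2) + v 0 0 *: partial_ 0)).
    exact: smooth_affine_xy.
  apply/funext => q; apply: heis_ext;
    rewrite /X1 /partial_ /xc /yc !mxE /= ?coordE; ring.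
have s2 : smooth_vf (fun q => v 0 1 *: X2 q).
  rewrite (_ : (fun q => _) = (fun q : heis R =>
    q 0 0 *: ((v 0 1 / 2) *: partial_ 2) + q 0 1 *: 0 + v 0 1 *: partial_ 1)).
    exact: smooth_affine_xy.
  apply/funext => q; apply: heis_ext;
    rewrite /X2 /partial_ /xc /yc !mxE /= ?coordE; ring.
have s3 : smooth_vf (fun q => f q *: X3 q).
  rewrite (_ : (fun q => _) = (fun q : heis R =>
    q 0 0 *: (- (v 0 1 / 2) *: partial_ 2) +
    q 0 1 *: ((v 0 0 / 2) *: partial_ 2) + v 0 2 *: partial_ 2)).
    exact: smooth_affine_xy.
  apply/funext => q; apply: heis_ext;
    rewrite /X3 /f /partial_ !mxE /= ?coordE /GRing.scale /=; ring.
have s12 : smooth_vf (fun q => v 0 0 *: X1 q + v 0 1 *: X2 q).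
  rewrite (_ : (fun q => _) = (fun q : heis R =>
    q 0 0 *: ((v 0 1 / 2) *: partial_ 2) +
    q 0 1 *: (- (v 0 0 / 2) *: partial_ 2) +
    (v 0 0 *: partial_ 0 + v 0 1 *: partial_ 1))).
    exact: smooth_affine_xy.
  apply/funext => q; apply: heis_ext;
    rewrite /X1 /X2 /partial_ /xc /yc !mxE /= ?coordE; ring.
rewrite /nabla_at (_ : (fun=> v) = (fun q =>
    (v 0 0 *: X1 q + v 0 1 *: X2 q) + f q *: X3 q)); last first.
  apply/funext => q; apply: heis_ext;
    rewrite /X1 /X2 /X3 /f /partial_ /xc /yc !mxE /= ?coordE /GRing.scale /=;
    ring.
rewrite (conn_addl nabla_conn s12 s3 sX) (conn_addl nabla_conn s1 s2 sX).
rewrite (conn_scalel nabla_conn sf smooth_X3 sX) e3.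
rewrite (conn_scalel nabla_conn (smooth_cst _ _) smooth_X1 sX) e1.
rewrite (conn_scalel nabla_conn (smooth_cst _ _) smooth_X2 sX) e2.
by rewrite !scaler0 !addr0.
Qed.

Lemma tw_nabla_X1 p v : nabla_at nabla p v X1 = 0.
Proof.
apply: tw_nabla_cst; first exact: smooth_X1.
- by move=> q; have [] := tw_frame_parallel q.
- by move=> q; have [] := tw_frame_parallel q.
- by move=> q; have [] := tw_reeb nabla_TW q.
Qed.

Lemma tw_nabla_X2 p v : nabla_at nabla p v X2 = 0.
Proof.
apply: tw_nabla_cst; first exact: smooth_X2.
- by move=> q; have [] := tw_frame_parallel q.
- by move=> q; have [] := tw_frame_parallel q.
- by move=> q; have [] := tw_reeb nabla_TW q.
Qed.

Lemma tw_nabla_partial_z p v : nabla_at nabla p v (fun=> partial_ 2) = 0.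
Proof. exact/tw_reeb_parallel/smooth_cst. Qed.

(** [X3] is parallel, so in the Leibniz rule only the derivative of the coefficient survives. *)
Lemma tw_nabla_coordZ_X3 (i : 'I_3) (a : R) p v :
  nabla_at nabla p v (fun q => (q 0 i * a) *: X3 q) = (v 0 i * a) *: partial_ 2.
Proof.
have sf : smooth_fun (fun q : heis R => q 0 i *: a).
  rewrite (_ : (fun q => _) = (fun q : heis R => q 0 i *: a + 0)).
    by apply: smooth_affine; [exact: linear_coordZ|exact: continuous_coordZ].
  by apply/funext => q; rewrite addr0.
rewrite /nabla_at (conn_leibniz nabla_conn sf (smooth_cst _ _) smooth_X3).
rewrite (tw_reeb_parallel nabla_TW (smooth_cst _ _)) scaler0 addr0.
rewrite (_ : (fun q => _) = (fun q : heis R => q 0 i *: a + 0)).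
  by rewrite derive_coordZ.
by apply/funext => q; rewrite addr0.
Qed.

Lemma tw_nabla_partial_x p v :
  nabla_at nabla p v (fun=> partial_ 0) = (v 0 1 * 2^-1) *: partial_ 2.
Proof.
rewrite (_ : (fun=> _) = (fun q => X1 q + (q 0 1 * 2^-1) *: X3 q)).
  rewrite /nabla_at (conn_addr nabla_conn (smooth_cst _ _) smooth_X1).
    by rewrite [X in X + _]tw_nabla_X1 add0r; exact: tw_nabla_coordZ_X3.
  exact: smooth_coordZ_X3.
by apply/funext => q; rewrite /X1 /X3 /yc subrK.
Qed.

Lemma tw_nabla_partial_y p v :
  nabla_at nabla p v (fun=> partial_ 1) = (v 0 0 * - 2^-1) *: partial_ 2.
Proof.
rewrite (_ : (fun=> _) = (fun q => X2 q + (q 0 0 * - 2^-1) *: X3 q)).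
  rewrite /nabla_at (conn_addr nabla_conn (smooth_cst _ _) smooth_X2).
    by rewrite [X in X + _]tw_nabla_X2 add0r; exact: tw_nabla_coordZ_X3.
  exact: smooth_coordZ_X3.
by apply/funext => q; rewrite /X2 /X3 /xc mulrN scaleNr addrK.
Qed.

(* The [partial_ 0] and [partial_ 1] corrections cancel in the [partial_ 2]
   direction because the velocity is differentiated along itself. *)
Lemma tw_covariant_derivative_velocity (zeta : R -> heis R) (t : R) :
  covariant_derivative_along nabla zeta (derive1 zeta) t =
  \row_j derive1 (fun s => derive1 zeta s 0 j) t.
Proof.
rewrite /covariant_derivative_along !big_ord_recl big_ord0.
have -> : ord0 = 0 :> 'I_3 by exact/val_inj.
have -> : lift 0 (ord0 : 'I_2) = 1 :> 'I_3 by exact/val_inj.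
have -> : lift 0 (lift ord0 (ord0 : 'I_1)) = 2 :> 'I_3 by exact/val_inj.
rewrite tw_nabla_partial_x tw_nabla_partial_y tw_nabla_partial_z.
by apply: heis_ext; rewrite /partial_ !mxE /= ?coordE; ring.
Qed.

End TanakaWebster.

(** * Velocity, acceleration and deviation in terms of the angle *)

Lemma smooth_on_derivable (R : realType) (V W : normedModType R) (U : set V)
    (f : V -> W) (p v : V) : smooth_on U f -> U p -> derivable f p v.
Proof. by move=> /(_ 1%N)[_ /(_ v)[+ _]]; apply. Qed.

Lemma derive1_coord (R : realType) (m n : nat) (M : R -> 'M[R]_(m, n)) (t : R)
    i j : derivable M t 1 -> derive1 (fun s => M s i j) t = derive1 M t i j.
Proof. by move=> dM; rewrite !derive1E derive_mx // mxE. Qed.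

Section AngleCurve.
Context {R : realType} {T : R} {zeta : R -> heis R} {theta : R -> R}.
Local Notation I := `]- T, T[.
Hypothesis zeta_derivable : forall t : R, I t -> derivable zeta t 1.
Hypothesis theta_derivable : forall t : R, I t -> derivable theta t 1.
Hypothesis zeta_angle : forall t : R, I t ->
  derive1 zeta t = cos (theta t) *: X1 (zeta t) + sin (theta t) *: X2 (zeta t).

Lemma angle_velocityE t : I t ->
  [/\ derive1 zeta t 0 0 = cos (theta t), derive1 zeta t 0 1 = sin (theta t) &
      derive1 zeta t 0 2 =
        (sin (theta t) * zeta t 0 0 - cos (theta t) * zeta t 0 1) * 2^-1].
Proof.
move=> It; rewrite (zeta_angle It).
by split; rewrite /X1 /X2 /partial_ /xc /yc !mxE /= ?coordE; ring.
Qed.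

(** The velocity formula is known on [I] only; differentiating it at [t] requires it on a
    neighbourhood of [t]. *)
Lemma near_angle_interval t : I t -> \forall s \near t, I s.
Proof.
by move=> It; apply: open_nbhs_nbhs; split=> //; exact: interval_open.
Qed.

Lemma angle_accelerationE t : I t ->
  \row_j derive1 (fun s => derive1 zeta s 0 j) t =
  derive1 theta t *:
    (- sin (theta t) *: X1 (zeta t) + cos (theta t) *: X2 (zeta t)).
Proof.
move=> It.
have nI := near_angle_interval It.
have dth : is_derive t 1 theta (derive1 theta t).
  by rewrite derive1E; exact/derivableP/theta_derivable.
have dcos := is_derive1_comp (is_derive_cos (theta t)) dth.
have dsin := is_derive1_comp (is_derive_sin (theta t)) dth.
have dz j : is_derive t 1 (fun s => zeta s 0 j) (derive1 zeta t 0 j).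
  rewrite -derive1_coord; last exact: zeta_derivable.
  rewrite derive1E; apply/derivableP.
  exact: ((derivable_mxP zeta t 1).1 (zeta_derivable It)).
have [v0 v1 _] := angle_velocityE It.
have a0 : derive1 (fun s => derive1 zeta s 0 0) t =
    - sin (theta t) * derive1 theta t.
  rewrite derive1E (near_eq_derive (g := cos \o theta)) ?derive_val //.
  by apply: filterS nI => s /angle_velocityE[].
have a1 : derive1 (fun s => derive1 zeta s 0 1) t =
    cos (theta t) * derive1 theta t.
  rewrite derive1E (near_eq_derive (g := sin \o theta)) ?derive_val //.
  by apply: filterS nI => s /angle_velocityE[].
(* The terms that differentiate the coordinates of [zeta] are [sin * cos] and [cos * sin], and
   cancel; only those with the derivative of [theta] remain. *)
have a2 : derive1 (fun s => derive1 zeta s 0 2) t =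
    derive1 theta t *
    ((cos (theta t) * zeta t 0 0 + sin (theta t) * zeta t 0 1) / 2).
  rewrite derive1E (near_eq_derive (g := 2^-1 \*:
    ((sin \o theta) * (fun s => zeta s 0 0) -
     (cos \o theta) * (fun s => zeta s 0 1)))); last first.
    apply: filterS nI => s /angle_velocityE[_ _ ->].
    by rewrite mulrC.
  have dz0 := dz 0; have dz1 := dz 1.
  rewrite derive_val v0 v1 /GRing.scale /=; ring.
apply: heis_ext; rewrite [LHS]mxE.
- by rewrite a0 /X1 /X2 /partial_ /xc /yc !mxE /= ?coordE; ring.
- by rewrite a1 /X1 /X2 /partial_ /xc /yc !mxE /= ?coordE; ring.
- by rewrite a2 /X1 /X2 /partial_ /xc /yc !mxE /= ?coordE; ring.
Qed.

(** In the plane, the acceleration is the derivative of [theta] times the velocity turned by a right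
    angle, and the velocity is a unit vector. *)
Lemma angle_char_deviation t : I t -> char_deviation zeta t = derive1 theta t.
Proof.
move=> It.
have nI := near_angle_interval It.
have der2 (j : 'I_3) : derive1n 2 (fun s => zeta s 0 j) t =
    (\row_j derive1 (fun s => derive1 zeta s 0 j) t) 0 j.
  rewrite mxE [LHS]derive1E [RHS]derive1E; apply: near_eq_derive.
  apply: filterS nI => s Is /=.
  by rewrite derive1_coord //; exact: zeta_derivable.
rewrite /char_deviation !(der2, derive1_coord); last 2 first.
- exact: zeta_derivable.
- exact: zeta_derivable.
have [-> -> _] := angle_velocityE It.
rewrite angle_accelerationE // /X1 /X2 /partial_ /xc /yc !mxE /= ?coordE.
(* The factor 1 is expanded as the sum of squares so that both sides become polynomially equal. *)
rewrite -[RHS]mulr1 -(cos2Dsin2 (theta t)); ring.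
Qed.

End AngleCurve.

(** * Norm of the acceleration and conclusion *)

Lemma normH_rotated_frame (R : realType) (p : heis R) (a h : R) :
  normH p (h *: (- sin a *: X1 p + cos a *: X2 p)) = `|h|.
Proof.
rewrite /normH scalerDr !scalerA gH_frame.
rewrite (_ : _ + _ = h ^+ 2); first exact: sqrtr_sqr.
rewrite -[RHS]mulr1 -(cos2Dsin2 a); ring.
Qed.

Theorem corollary5p6 (R : realType) (T : R) (zeta : R -> heis R)
  (theta : R -> R) (nabla : vfield R -> vfield R -> vfield R)
  (T_gt0 : 0 < T)
  (zeta_smooth : smooth_on `]- T, T[ zeta)
  (zeta_horizontal : horizontal_curve `]- T, T[ zeta)
  (zeta_arc_length : arc_length_param `]- T, T[ zeta)
  (theta_smooth : smooth_on `]- T, T[ theta)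
  (zeta_angle : forall t : R, `]- T, T[ t ->
     derive1 zeta t = cos (theta t) *: X1 (zeta t) + sin (theta t) *: X2 (zeta t))
  (nabla_TW : tanaka_webster nabla) :
  (forall t : R, `]- T, T[ t ->
     covariant_derivative_along nabla zeta (derive1 zeta) t =
     char_deviation zeta t *:
       (- sin (theta t) *: X1 (zeta t) + cos (theta t) *: X2 (zeta t))) /\
  (forall t : R, `]- T, T[ t ->
     normH (zeta t) (covariant_derivative_along nabla zeta (derive1 zeta) t) =
     `|char_deviation zeta t|).
Proof.
have zeta_der t : `]- T, T[ t -> derivable zeta t 1.
  exact: smooth_on_derivable zeta_smooth.
have theta_der t : `]- T, T[ t -> derivable theta t 1.
  exact: smooth_on_derivable theta_smooth.
have acc t : `]- T, T[ t ->
    covariant_derivative_along nabla zeta (derive1 zeta) t =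
    char_deviation zeta t *:
      (- sin (theta t) *: X1 (zeta t) + cos (theta t) *: X2 (zeta t)).
  move=> It; rewrite (tw_covariant_derivative_velocity nabla_TW).
  rewrite (angle_accelerationE zeta_der theta_der zeta_angle It).
  by rewrite (angle_char_deviation zeta_der theta_der zeta_angle It).
by split=> [//|t It]; rewrite acc // normH_rotated_frame.
Qed.
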